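(* Let $L$ be any lattice that admits a lattice homomorphism onto a free bounded lattice with $\aleph_2$ generators in the variety of lattices generated by either $M_3$ or $N_5$. Then $\mathbf{C}(L)$ does not satisfy the WURP at $\mathbf{1}$. In particular, there exists no congruence splitting lattice $K$ such that $\mathbf{C}(K)\cong\mathbf{C}(L)$; furthermore, $\mathbf{C}(L)$ does not satisfy Schmidt's condition.
   Context: Semilattices are join-semilattices with least element $0$. For a lattice $L$, $\mathbf{C}(L)$ denotes the congruence semilattice of $L$: the join-semilattice with zero of all compact congruences of $L$, under the join of congruences. $\mathbf{1}$ denotes the largest congruence of $L$. For $a,b\in L$, $\Theta(a,b)$ denotes the least congruence of $L$ containing the pair $(a,b)$. $M_3$ (the diamond) is the five-element lattice consisting of a least element, a greatest element and three pairwise incomparable atoms; $N_5$ (the pentagon) is the five-element lattice $\{0,a,b,c,1\}$ with $0<c<a<1$, $0<b<1$, $a\wedge b=0$, $c\vee b=1$. The free bounded lattice on a set $X$ in a variety $\mathcal{V}$ of lattices is the free object on $X$ in the class of bounded lattices (with the constants $0,1$ in the signature) whose underlying lattice belongs to $\mathcal{V}$. WURP (weak uniform refinement property). Let $S$ be a semilattice and let $e\in S$. The WURP holds at $e$ in $S$ (equivalently, $S$ satisfies the WURP at $e$) when for all families $(a_i)_{i\in I}$ and $(b_i)_{i\in I}$ of elements of $S$ such that $a_i\vee b_i=e$ for all $i\in I$, there is a family $(c_{ij})_{(i,j)\in I\times I}$ of elements of $S$ such that for all $i,j,k\in I$: (i$'$) $c_{ij}\le a_i$ and $c_{ij}\le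 b_j$; (ii$'$) $c_{ij}\vee a_j\vee b_i=e$; (iii$'$) $c_{ik}\le c_{ij}\vee c_{jk}$. A lattice $K$ is congruence splitting when for all $a\le b$ in $K$ and all congruences $\boldsymbol{a}_0,\boldsymbol{a}_1$ of $K$, if $\Theta(a,b)=\boldsymbol{a}_0\vee\boldsymbol{a}_1$, then there exist elements $x_0,x_1$ of the interval $[a,b]$ such that $x_0\vee x_1=b$ and $\Theta(a,x_i)\subseteq\boldsymbol{a}_i$ for all $i<2$. A homomorphism of semilattices $\mu:S\to T$ is weak-distributive when for all $e\in S$ and all $b_0,b_1\in T$ such that $\mu(e)=b_0\vee b_1$, there are $a_0,a_1\in S$ such that $\mu(a_0)\le b_0$, $\mu(a_1)\le b_1$ and $e=a_0\vee a_1$. A distributive semilattice satisfies Schmidt's condition when it is the image of a generalized Boolean algebra (a distributive lattice with $0$ in which every interval $[0,x]$ is complemented, viewed as a join-semilattice with zero) under a weak-distributive homomorphism. *)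

(* Defs.v *)
From HB Require Import structures.
From mathcomp Require Import all_boot all_order.
From mathcomp Require Import boolp classical_sets functions cardinality.

Set Implicit Arguments.
Unset Strict Implicit.
Unset Printing Implicit Defensive.

Import Order.LTheory.
#[local] Obligation Tactic := idtac.
Local Open Scope order_scope.

Record congruence d (L : latticeType d) := Congruence {
  con_rel :> L -> L -> Prop;
  con_refl : forall x, con_rel x x;
  con_sym : forall x y, con_rel x y -> con_rel y x;
  con_trans : forall x y z, con_rel x y -> con_rel y z -> con_rel x z;
  con_meet : forall x x' y y',
    con_rel x x' -> con_rel y y' -> con_rel (x `&` y) (x' `&` y');
  con_join : forall x x' y y',
    con_rel x x' -> con_rel y y' -> con_rel (x `|` y) (x' `|` y')
}.

Lemma congruence_ext d (L : latticeType d) (s t : congruence L) :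
  (forall x y, s x y <-> t x y) -> s = t.
Proof.
case: s t => [s s1 s2 s3 s4 s5] [t t1 t2 t3 t4 t5] /= st.
have E : s = t by apply/funext=> x; apply/funext=> y; apply/propext.
by subst t; congr Congruence; exact: Prop_irrelevance.
Qed.

Fact con_display : Order.disp_t. Proof. exact: (Order.Disp tt tt). Qed.

Section CongruenceLattice.
Context d (L : latticeType d).
Implicit Types (s t u : congruence L) (R : L -> L -> Prop).

Program Definition con_gen R : congruence L := @Congruence d L
  (fun x y => forall t, (forall a b, R a b -> t a b) -> t x y) _ _ _ _ _.
Next Obligation. by move=> R x t _; exact: con_refl. Qed.
Next Obligation. by move=> R x y H t Rt; apply: con_sym; exact: H. Qed.
Next Obligation.
by move=> R x y z H H' t Rt; apply: con_trans (H t Rt) (H' t Rt).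
Qed.
Next Obligation.
by move=> R x x' y y' H H' t Rt; exact: con_meet (H t Rt) (H' t Rt).
Qed.
Next Obligation.
by move=> R x x' y y' H H' t Rt; exact: con_join (H t Rt) (H' t Rt).
Qed.

Program Definition con_cap s t : congruence L := @Congruence d L
  (fun x y => s x y /\ t x y) _ _ _ _ _.
Next Obligation. by move=> s t x; split; exact: con_refl. Qed.
Next Obligation. by move=> s t x y []; split; exact: con_sym. Qed.
Next Obligation.
by move=> s t x y z [? ?] [? ?]; split; apply: con_trans; eassumption.
Qed.
Next Obligation. by move=> s t x x' y y' [? ?] [? ?]; split; exact: con_meet. Qed.
Next Obligation. by move=> s t x x' y y' [? ?] [? ?]; split; exact: con_join. Qed.

Definition con_cup s t := con_gen (fun x y => s x y \/ t x y).

Program Definition con_eq : congruence L :=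
  @Congruence d L (fun x y => x = y) _ _ _ _ _.
Next Obligation. by []. Qed.
Next Obligation. by move=> x y ->. Qed.
Next Obligation. by move=> x y z ->. Qed.
Next Obligation. by move=> x x' y y' -> ->. Qed.
Next Obligation. by move=> x x' y y' -> ->. Qed.

Program Definition con_full : congruence L :=
  @Congruence d L (fun _ _ => True) _ _ _ _ _.
Solve All Obligations with by [].

Definition con_le s t : bool := `[< forall x y, s x y -> t x y >].

Fact con_le_refl : reflexive con_le. Proof. by move=> s; apply/asboolP. Qed.

Fact con_le_anti : antisymmetric con_le.
Proof.
move=> s t /andP[/asboolP st /asboolP ts].
by apply: congruence_ext => x y; split; [exact: st | exact: ts].
Qed.

Fact con_le_trans : transitive con_le.
Proof.
move=> t s u /asboolP st /asboolP tu; apply/asboolP=> x y sxy.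
exact/tu/st.
Qed.

HB.instance Definition _ := gen_eqMixin (congruence L).
HB.instance Definition _ := gen_choiceMixin (congruence L).
HB.instance Definition _ := Order.Le_isPOrder.Build con_display (congruence L)
  con_le_refl con_le_anti con_le_trans.

Lemma con_leP s t : reflect (forall x y, s x y -> t x y) (s <= t).
Proof. exact: asboolP. Qed.

Fact con_capP s t u : (s <= con_cap t u) = (s <= t) && (s <= u).
Proof.
apply/con_leP/andP => [H|[/con_leP st /con_leP su] x y sxy].
  by split; apply/con_leP=> x y /H[].
by split; [exact: st | exact: su].
Qed.

Lemma con_genP R t : reflect (forall a b, R a b -> t a b) (con_gen R <= t).
Proof.
apply: (iffP (con_leP _ _)) => [H a b Rab|Rt x y]; last exact.
by apply: H => u; exact.
Qed.

Fact con_cupP s t u : (con_cup s t <= u) = (s <= u) && (t <= u).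
Proof.
apply/con_genP/andP => [H|[/con_leP su /con_leP tu] x y []]; last 2 first.
- exact: su.
- exact: tu.
by split; apply/con_leP => x y xy; apply: H; [left | right].
Qed.

HB.instance Definition _ := Order.POrder_MeetJoin_isLattice.Build
  con_display (congruence L) con_capP con_cupP.

Fact con_le0x s : con_eq <= s.
Proof. by apply/con_leP=> x y /= ->; exact: con_refl. Qed.

Fact con_lex1 s : s <= con_full. Proof. exact/con_leP. Qed.

HB.instance Definition _ :=
  Order.hasBottom.Build con_display (congruence L) con_le0x.
HB.instance Definition _ :=
  Order.hasTop.Build con_display (congruence L) con_lex1.

Definition Theta (a b : L) : congruence L :=
  con_gen (fun x y => x = a /\ y = b).

Definition con_sup (D : set (congruence L)) : congruence L :=
  con_gen (fun x y => exists2 s, D s & s x y).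

Lemma con_supP (D : set (congruence L)) t :
  reflect (forall s, D s -> s <= t) (con_sup D <= t).
Proof.
apply: (iffP (con_genP _ _)) => [H s Ds|H x y [s /H/con_leP]]; last exact.
by apply/con_leP=> x y sxy; apply: H; exists s.
Qed.

Definition con_compact t : Prop := forall D : set (congruence L),
  t <= con_sup D ->
  exists E : set (congruence L),
    [/\ finite_set E, (E `<=` D)%classic & t <= con_sup E].

End CongruenceLattice.

Record compact_congruence d (L : latticeType d) := CompactCongruence {
  ccon_val :> congruence L;
  ccon_compact : `[< con_compact ccon_val >]
}.

Section CongruenceSemilattice.
Context d (L : latticeType d).
Local Notation CL := (compact_congruence L).

HB.instance Definition _ := [isSub for @ccon_val d L].
HB.instance Definition _ := [Choice of CL by <:].

Definition ccon_le (s t : CL) : bool := ccon_val s <= ccon_val t.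
Fact ccon_le_refl : reflexive ccon_le. Proof. by move=> s; exact: lexx. Qed.
Fact ccon_le_anti : antisymmetric ccon_le.
Proof. by move=> s t st; apply/val_inj/le_anti. Qed.
Fact ccon_le_trans : transitive ccon_le.
Proof. by move=> t s u; exact: le_trans. Qed.

HB.instance Definition _ := Order.Le_isPOrder.Build con_display CL
  ccon_le_refl ccon_le_anti ccon_le_trans.

Lemma compact0 : con_compact (\bot : congruence L).
Proof.
move=> D _; exists set0; split; first exact: finite_set0.
  exact: sub0set.
exact: le0x.
Qed.

Lemma compactU (s t : congruence L) :
  con_compact s -> con_compact t -> con_compact (s `|` t).
Proof.
move=> cs ct D; rewrite leUx => /andP[/cs[E [Ef ED sE]] /ct[E' [E'f E'D tE']]].
exists (E `|` E')%classic; split; first by rewrite finite_setU.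
  by move=> u [/ED|/E'D].
rewrite leUx; apply/andP; split.
- apply: (le_trans sE); apply/con_supP=> u Eu.
  by apply/con_leP=> x y uxy v; apply; exists u => //; left.
- apply: (le_trans tE'); apply/con_supP=> u Eu.
  by apply/con_leP=> x y uxy v; apply; exists u => //; right.
Qed.

Definition ccon_join (s t : CL) : CL :=
  CompactCongruence (asboolT (compactU (asboolW (ccon_compact s))
                                       (asboolW (ccon_compact t)))).

Fact ccon_leUx (s t u : CL) : (ccon_join s t <= u) = (s <= u) && (t <= u).
Proof. exact: leUx. Qed.

HB.instance Definition _ :=
  Order.POrder_isJoinSemilattice.Build con_display CL ccon_leUx.

Definition ccon_bot : CL := CompactCongruence (asboolT compact0).

Fact ccon_le0x (s : CL) : ccon_bot <= s.
Proof. exact: le0x. Qed.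

HB.instance Definition _ := Order.hasBottom.Build con_display CL ccon_le0x.

End CongruenceSemilattice.

Definition WURP_at d (S : bJoinSemilatticeType d) (e : S) : Prop :=
  forall (I : Type) (a b : I -> S),
    (forall i, a i `|` b i = e) ->
    exists c : I -> I -> S,
      [/\ forall i j, c i j <= a i /\ c i j <= b j,
          forall i j, c i j `|` a j `|` b i = e
        & forall i j k, c i k <= c i j `|` c j k].

Definition slat_hom d (S : bJoinSemilatticeType d)
    d' (T : bJoinSemilatticeType d') (mu : S -> T) : Prop :=
  mu \bot = \bot /\ {morph mu : x y / x `|` y}.

Definition slat_iso d (S : bJoinSemilatticeType d)
    d' (T : bJoinSemilatticeType d') : Prop :=
  exists mu : S -> T, slat_hom mu /\ bijective mu.

Definition weak_distributive d (S : bJoinSemilatticeType d)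
    d' (T : bJoinSemilatticeType d') (mu : S -> T) : Prop :=
  forall (e : S) (b0 b1 : T), mu e = b0 `|` b1 ->
    exists a0 a1 : S, [/\ mu a0 <= b0, mu a1 <= b1 & e = a0 `|` a1].

(* [cbDistrLatticeType] is the class of generalized Boolean algebras; the
   distributivity of [S] is not part of the definition (congruence
   semilattices of lattices are always distributive). *)
Definition Schmidt d (S : bJoinSemilatticeType d) : Prop :=
  exists (dB : Order.disp_t) (B : cbDistrLatticeType dB) (mu : B -> S),
    [/\ slat_hom mu, weak_distributive mu & forall y, exists x, mu x = y].

Definition congruence_splitting d (K : latticeType d) : Prop :=
  forall (a b : K) (a0 a1 : congruence K),
    a <= b -> Theta a b = a0 `|` a1 ->
    exists x0 x1 : K,
      [/\ a <= x0 <= b, a <= x1 <= b, x0 `|` x1 = b,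
          Theta a x0 <= a0 & Theta a x1 <= a1].

Inductive M3 : Type := M3_0 | M3_a | M3_b | M3_c | M3_1.

Definition M3_le (x y : M3) : bool :=
  match x, y with
  | M3_0, _ | _, M3_1 | M3_a, M3_a | M3_b, M3_b | M3_c, M3_c => true
  | _, _ => false
  end.

Definition M3_meet (x y : M3) : M3 :=
  if M3_le x y then x else if M3_le y x then y else M3_0.
Definition M3_join (x y : M3) : M3 :=
  if M3_le x y then y else if M3_le y x then x else M3_1.

(* [c < a], and [b] is incomparable to both. *)
Inductive N5 : Type := N5_0 | N5_a | N5_b | N5_c | N5_1.

Definition N5_le (x y : N5) : bool :=
  match x, y with
  | N5_0, _ | _, N5_1 | N5_a, N5_a | N5_b, N5_b | N5_c, N5_c
  | N5_c, N5_a => true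
  | _, _ => false
  end.

Definition N5_meet (x y : N5) : N5 :=
  if N5_le x y then x else if N5_le y x then y else N5_0.
Definition N5_join (x y : N5) : N5 :=
  if N5_le x y then y else if N5_le y x then x else N5_1.

Definition M3_code (x : M3) : nat :=
  match x with M3_0 => 0 | M3_a => 1 | M3_b => 2 | M3_c => 3 | M3_1 => 4 end.
Definition M3_decode (n : nat) : M3 := nth M3_1 [:: M3_0; M3_a; M3_b; M3_c] n.
Fact M3_codeK : cancel M3_code M3_decode. Proof. by case. Qed.

Definition N5_code (x : N5) : nat :=
  match x with N5_0 => 0 | N5_a => 1 | N5_b => 2 | N5_c => 3 | N5_1 => 4 end.
Definition N5_decode (n : nat) : N5 := nth N5_1 [:: N5_0; N5_a; N5_b; N5_c] n.
Fact N5_codeK : cancel N5_code N5_decode. Proof. by case. Qed.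

Fact M3_display : Order.disp_t. Proof. exact: (Order.Disp tt tt). Qed.
Fact N5_display : Order.disp_t. Proof. exact: (Order.Disp tt tt). Qed.

HB.instance Definition _ := Countable.copy M3 (can_type M3_codeK).
HB.instance Definition _ := Countable.copy N5 (can_type N5_codeK).

Fact M3_le_refl : reflexive M3_le. Proof. by case. Qed.
Fact M3_le_anti : antisymmetric M3_le. Proof. by case; case. Qed.
Fact M3_le_trans : transitive M3_le. Proof. by case; case; case. Qed.
HB.instance Definition _ := Order.Le_isPOrder.Build M3_display M3
  M3_le_refl M3_le_anti M3_le_trans.
Fact M3_meetP (x y z : M3) : (x <= M3_meet y z) = (x <= y) && (x <= z).
Proof. by case: x; case: y; case: z. Qed.
Fact M3_joinP (x y z : M3) : (M3_join x y <= z) = (x <= z) && (y <= z).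
Proof. by case: x; case: y; case: z. Qed.
HB.instance Definition _ := Order.POrder_MeetJoin_isLattice.Build
  M3_display M3 M3_meetP M3_joinP.

Fact N5_le_refl : reflexive N5_le. Proof. by case. Qed.
Fact N5_le_anti : antisymmetric N5_le. Proof. by case; case. Qed.
Fact N5_le_trans : transitive N5_le. Proof. by case; case; case. Qed.
HB.instance Definition _ := Order.Le_isPOrder.Build N5_display N5
  N5_le_refl N5_le_anti N5_le_trans.
Fact N5_meetP (x y z : N5) : (x <= N5_meet y z) = (x <= y) && (x <= z).
Proof. by case: x; case: y; case: z. Qed.
Fact N5_joinP (x y z : N5) : (N5_join x y <= z) = (x <= z) && (y <= z).
Proof. by case: x; case: y; case: z. Qed.
HB.instance Definition _ := Order.POrder_MeetJoin_isLattice.Build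
  N5_display N5 N5_meetP N5_joinP.

Inductive lterm : Type :=
  | LVar of nat
  | LMeet of lterm & lterm
  | LJoin of lterm & lterm.

Fixpoint leval d (L : latticeType d) (v : nat -> L) (p : lterm) : L :=
  match p with
  | LVar n => v n
  | LMeet p q => leval v p `&` leval v q
  | LJoin p q => leval v p `|` leval v q
  end.

(* [L] belongs to the variety (equational class) defined by the set of lattice
   identities [E]. *)
Definition models d (L : latticeType d) (E : set (lterm * lterm)) : Prop :=
  forall pq, E pq -> forall v : nat -> L, leval v pq.1 = leval v pq.2.

(* [L] belongs to every variety that contains [A]. *)
Definition variety_gen dA (A : latticeType dA) d (L : latticeType d) : Prop :=
  forall E : set (lterm * lterm), models A E -> models L E.

(* The homomorphism [h] is a lattice homomorphism with explicit preservation
   of the bounds: in MathComp 2.5 [{tblmorphism T -> T'}] only asserts the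
   latter, not that meets and joins are preserved. *)
Definition free_bounded_lattice
    (V : forall d, latticeType d -> Prop)
    (X : Type) d (F : tbLatticeType d) (iota : X -> F) : Prop :=
  V d F /\
  forall dB (B : tbLatticeType dB) (g : X -> B), V dB B ->
    exists h : {lmorphism F -> B},
      [/\ h \bot = \bot, h \top = \top, forall x, h (iota x) = g x
        & forall h' : {lmorphism F -> B},
            h' \bot = \bot -> h' \top = \top ->
            (forall x, h' (iota x) = g x) -> h' =1 h].

(* [A] has cardinality aleph_n. Since every cardinal below that of [A] is
   realized by a subset of [A], only such subsets are considered: aleph_(n+1)
   is the cardinality of a set [A] with a strictly smaller subset [B] of
   cardinality aleph_n and no subset of cardinality strictly in between. *)
Fixpoint card_aleph (n : nat) (T : Type) (A : set T) : Prop :=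
  match n with
  | 0 => (A #= [set: nat])%card
  | m.+1 => exists B : set T,
      [/\ (B `<=` A)%classic, card_aleph m B, ~ (A #<= B)%card
        & forall C : set T, (C `<=` A)%classic ->
            (C #<= B)%card \/ (A #<= C)%card]
  end.

(* Main.v *)
Require Import Defs.
From Stdlib Require Import Relation_Operators.
From HB Require Import structures.
From mathcomp Require Import all_boot all_order.
From mathcomp Require Import boolp classical_sets functions cardinality.

Set Implicit Arguments.
Unset Strict Implicit.
Unset Printing Implicit Defensive.

(** The theorem rests on one non-distributive feature of the variety: a bounded
    lattice [D] in it with an element [q] having two complements [p] and [r],
    where [r <= p] fails. In [M3] the three atoms will do; in [N5] one takes
    [p = c], [q = b], [r = a].

    Let [x_i] ([i] in [X]) be the free generators, lifted to an interval
    [[z0, z1]] of [L] that [f] sends onto bounds. Put [u_i = Theta z0 x_i] and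
    [v_i = Theta x_i z1], so that [u_i `|` v_i = Theta z0 z1] for
    every [i]. The refinement property is applied to the family indexed by
    [X * bool] in which each decomposition appears twice, once as [(v_i, u_i)]
    and once as [(u_i, v_i)]. It yields compact congruences, and whether a
    homomorphism from [F] to [D] kills a given one depends on the values on
    finitely many generators only ([compact_finite_support]). As [X] has
    cardinality aleph_2, Kuratowski's theorem ([free_triple]) provides [i], [j],
    [k] such that the congruence attached to each two of them does not depend
    on the third. Write [h_abc] for the homomorphism [F -> D] that maps [x_i],
    [x_j], [x_k] to [a], [b], [c] and all other generators to [\bot].
    - The congruence [c_ij] of [(i, false)] and [(j, true)] lies below both [v_i]
      and [v_j], hence is killed by [h_100] and by [h_010]. Since [p] and [q] are
      complementary, these two maps determine [h_pq0], which therefore kills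
      [c_ij]; and [c_ij] does not see [x_k], so [h_pqr] kills it.
    - Symmetrically [c_jk] lies below [u_j] and [u_k], and [h_pqr] kills it.
    - So [h_pqr] kills [c_ik], which lies below the join of both; as [c_ik] does
      not see [x_j], it is killed by [h_p0r], and by [h_001] because
      [r <= p] fails. But [h_001] also kills [v_k] and [u_i], whose join with
      [c_ik] is [Theta z0 z1]: it would identify the two bounds of [D].
    This gives the failure at every [Theta z0 z1] as above
    ([WURP_fails_at_Theta]), and the largest congruence has this form as soon as
    it is compact ([compact_le_Theta]).

    For the last two claims, the property holds at every element of a
    generalized Boolean algebra ([WURP_genBoolean]) and of the congruence
    semilattice of a congruence splitting lattice
    ([WURP_congruence_splitting]), and it is carried along weak-distributive
    homomorphisms ([WURP_weak_distributive]). When the largest congruence of [L]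
    is not compact, these claims still follow from the failure at
    [Theta z0 z1]. *)

Import Order.LTheory Order.CTheory.
#[local] Obligation Tactic := idtac.
Local Open Scope order_scope.

(** * Principal and compact congruences *)

Section Congruences.
Context d (L : latticeType d).
Implicit Types (s t u : congruence L) (a b x y z : L).

Lemma Theta_leP a b t : reflect (t a b) (Theta a b <= t).
Proof.
apply: (iffP (con_genP _ _)) => [|tab x y [-> ->] //].
by apply.
Qed.

Lemma Theta_refl a b : Theta a b a b.
Proof. exact/Theta_leP. Qed.
Arguments Theta_refl : clear implicits.

Lemma Theta_meet_join a b : Theta (a `&` b) (a `|` b) = Theta a b.
Proof.
apply/le_anti/andP; split; apply/Theta_leP.
  have ab := Theta_refl a b.
  apply: (@con_trans _ _ _ _ b).
    by have := con_meet ab (con_refl _ b); rewrite meetxx.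
  by have := con_join (con_sym ab) (con_refl _ b); rewrite joinxx.
set t := Theta _ _; have tmj : t (a `&` b) (a `|` b) by exact: Theta_refl.
have tm x : a `&` b <= x -> x <= a `|` b -> t x (a `|` b).
  move=> mx xj; have := con_join (con_refl t x) tmj.
  by rewrite (join_idPl mx) (join_idPr xj).
apply: con_trans (tm a _ _) (con_sym (tm b _ _)).
- exact: leIl.
- exact: leUl.
- exact: leIr.
- exact: leUr.
Qed.

Lemma Theta_split a b c : a <= b <= c -> Theta a b `|` Theta b c = Theta a c.
Proof.
move=> /andP[ab bc]; apply/le_anti; rewrite leUx; apply/andP; split.
  have ac := Theta_refl a c.
  apply/andP; split; apply/Theta_leP.
    have := con_meet ac (con_refl _ b).
    by rewrite (meet_idPl ab) (meet_idPr bc).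
  have := con_join ac (con_refl _ b).
  by rewrite (join_idPr ab) (join_idPl bc).
apply/Theta_leP; apply: (@con_trans _ _ _ _ b).
  by move/con_leP: (leUl (Theta a b) (Theta b c)); apply; exact: Theta_refl.
by move/con_leP: (leUr (Theta b c) (Theta a b)); apply; exact: Theta_refl.
Qed.

Lemma con_sup_sub (D E : set (congruence L)) :
  (D `<=` E)%classic -> con_sup D <= con_sup E.
Proof.
move=> DE; apply/con_supP => s Ds; apply/con_leP => x y sxy v; apply.
by exists s => //; exact: DE.
Qed.

(** Joins of finite subfamilies of [D], glued together: this is the join of [D],
    presented so that membership of one pair exhibits a finite subfamily. *)
Program Definition con_finsup (D : set (congruence L)) : congruence L :=
  @Congruence d L (fun x y => exists E : set (congruence L),
    [/\ finite_set E, (E `<=` D)%classic & con_sup E x y]) _ _ _ _ _.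
Next Obligation.
move=> D x; exists set0; split; first exact: finite_set0.
  exact: sub0set.
exact: (con_refl (con_sup set0)).
Qed.
Next Obligation.
by move=> D x y [E [fE ED xy]]; exists E; split=> //; exact: con_sym xy.
Qed.
Next Obligation.
move=> D x y z [E [fE ED xy]] [E' [fE' ED' yz]].
exists (E `|` E')%classic; split; first by rewrite finite_setU.
  by move=> u [/ED|/ED'].
apply: (@con_trans _ _ (con_sup _) _ y).
  exact: (con_leP _ _ (con_sup_sub (@subsetUl _ E E'))).
exact: (con_leP _ _ (con_sup_sub (@subsetUr _ E E'))).
Qed.
Next Obligation.
move=> D x x' y y' [E [fE ED xy]] [E' [fE' ED' yz]].
exists (E `|` E')%classic; split; first by rewrite finite_setU.
  by move=> u [/ED|/ED'].
apply: (@con_meet _ _ (con_sup _)).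
  exact: (con_leP _ _ (con_sup_sub (@subsetUl _ E E'))).
exact: (con_leP _ _ (con_sup_sub (@subsetUr _ E E'))).
Qed.
Next Obligation.
move=> D x x' y y' [E [fE ED xy]] [E' [fE' ED' yz]].
exists (E `|` E')%classic; split; first by rewrite finite_setU.
  by move=> u [/ED|/ED'].
apply: (@con_join _ _ (con_sup _)).
  exact: (con_leP _ _ (con_sup_sub (@subsetUl _ E E'))).
exact: (con_leP _ _ (con_sup_sub (@subsetUr _ E E'))).
Qed.

Lemma Theta_compact a b : con_compact (Theta a b).
Proof.
move=> D /Theta_leP Dab.
have /con_leP/(_ _ _ Dab) : con_sup D <= con_finsup D.
  apply/con_supP => s Ds; apply/con_leP => x y sxy; exists [set s]%classic.
  split; [exact: finite_set1 | by move=> _ -> |].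
  by move=> v; apply; exists s.
by case=> E [fE ED Eab]; exists E; split => //; exact/Theta_leP.
Qed.

Definition Theta_c a b : compact_congruence L :=
  CompactCongruence (asboolT (@Theta_compact a b)).

Lemma con_sup_seq_ind (Q : congruence L -> Prop) (l : seq (congruence L)) :
  Q \bot -> (forall s t, Q s -> Q t -> Q (s `|` t)) ->
  (forall s, s \in l -> Q s) -> Q (con_sup [set` l]%classic).
Proof.
move=> Q0 QU; elim: l => [|s l IHl] Ql.
  rewrite (_ : con_sup _ = \bot)//; apply/le_anti; rewrite le0x andbT.
  by apply/con_supP.
rewrite (_ : con_sup _ = s `|` con_sup [set` l]%classic).
  apply: QU; first by apply: Ql; exact: mem_head.
  by apply: IHl => u ul; apply: Ql; rewrite inE ul orbT.
apply/le_anti/andP; split.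
  apply/con_supP => u /=; rewrite inE => /predU1P[->|ul]; first exact: leUl.
  by apply: le_trans (leUr _ _); apply/con_leP => x y uxy v; apply; exists u.
rewrite leUx; apply/andP; split.
  by apply/con_leP => x y sxy v; apply; exists s => //=; exact: mem_head.
by apply: con_sup_sub => u /= ul; rewrite inE ul orbT.
Qed.

(** A compact congruence is a finite join of principal ones, and the generating
    pairs may be taken comparable; properties of compact congruences are proved
    by this induction. *)
Lemma compact_ind (Q : congruence L -> Prop) :
  Q \bot -> (forall s t, Q s -> Q t -> Q (s `|` t)) ->
  (forall a b, a <= b -> Q (Theta a b)) ->
  forall t, con_compact t -> Q t.
Proof.
move=> Q0 QU QT t ct.
pose D s := exists x y, t x y /\ s = Theta x y.
have [|E [/finite_seqP[l El] ED tE]] := ct D.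
  apply/con_leP => x y txy v; apply; exists (Theta x y); last exact: Theta_refl.
  by exists x, y.
have -> : t = con_sup E.
  apply/le_anti; rewrite tE; apply/con_supP => _ /ED[x [y [txy ->]]].
  exact/Theta_leP.
rewrite El in ED *; apply: con_sup_seq_ind => // s /ED[x [y [_ ->]]].
by rewrite -Theta_meet_join; apply: QT; exact: le_trans (leIl _ _) (leUl _ _).
Qed.

End Congruences.
Arguments Theta_refl {d L} a b.

(** * Distributivity of the congruence lattice *)

Section Distributivity.
Context d (L : latticeType d).
Implicit Types (s t u : congruence L) (x y z : L).

(** The majority term of lattices, which is what makes congruence lattices of
    lattices distributive. *)
Definition median x y z := (x `&` y) `|` (x `&` z) `|` (y `&` z).

Lemma median_con s x y z z' : s z z' -> s (median x y z) (median x y z').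
Proof.
by move=> *; do !apply: con_join; apply: con_meet => //; exact: con_refl.
Qed.

Lemma medianxyx x y : median x y x = x.
Proof. by rewrite /median meetxx [y `&` x]meetC joinAC joinxx meetUKC. Qed.

Lemma medianxyy x y : median x y y = y.
Proof. by rewrite /median meetxx joinxx meetUK. Qed.

Lemma medianxxz x z : median x x z = x.
Proof. by rewrite /median meetxx -joinA joinxx meetKU. Qed.

Local Notation chain s t :=
  (clos_refl_trans L (fun x y => s x y \/ t x y)).

Lemma chain_unary s t (h : L -> L) x y :
  (forall u, u = s \/ u = t -> forall a b, u a b -> u (h a) (h b)) ->
  chain s t x y -> chain s t (h x) (h y).
Proof.
move=> hP; elim=> {x y} [x y [xy|xy]|x|x y z _ IHx _ IHy].
- by apply: rt_step; left; apply: hP => //; left.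
- by apply: rt_step; right; apply: hP => //; right.
- exact: rt_refl.
- exact: rt_trans IHx IHy.
Qed.

(** The join of [s] and [t], in a form that allows induction along a chain. *)
Program Definition con_chain s t : congruence L :=
  @Congruence d L (chain s t) _ _ _ _ _.
Next Obligation. by move=> s t x; exact: rt_refl. Qed.
Next Obligation.
move=> s t x y; elim=> {x y} [x y [xy|xy]|x|x y z _ IHx _ IHy].
- by apply: rt_step; left; exact: con_sym.
- by apply: rt_step; right; exact: con_sym.
- exact: rt_refl.
- exact: rt_trans IHy IHx.
Qed.
Next Obligation. by move=> s t x y z; exact: rt_trans. Qed.
Next Obligation.
move=> s t x x' y y' xx' yy'; apply: (rt_trans _ _ _ (x' `&` y)).
  apply: (@chain_unary s t (fun z => z `&` y)) xx' => u _ a b ab.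
  exact: con_meet ab (con_refl _ _).
apply: (@chain_unary s t (fun z => x' `&` z)) yy' => u _ a b ab.
exact: con_meet (con_refl _ _) ab.
Qed.
Next Obligation.
move=> s t x x' y y' xx' yy'; apply: (rt_trans _ _ _ (x' `|` y)).
  apply: (@chain_unary s t (fun z => z `|` y)) xx' => u _ a b ab.
  exact: con_join ab (con_refl _ _).
apply: (@chain_unary s t (fun z => x' `|` z)) yy' => u _ a b ab.
exact: con_join (con_refl _ _) ab.
Qed.

(** A chain from [x] to [y] with steps in [t] or [u] is moved inside the class of
    [x] modulo [s] by applying [median x y], which keeps both ends and turns
    every point into one congruent to [x] modulo [s]. *)
Lemma con_meetUr s t u : s `&` (t `|` u) <= (s `&` t) `|` (s `&` u).
Proof.
set v := (s `&` t) `|` _.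
have le_v w x y : w <= v -> w x y -> v x y by move/con_leP; apply.
apply/con_leP => x y [sxy tuxy].
have {tuxy} : con_chain t u x y.
  suff /con_leP : t `|` u <= con_chain t u by apply.
  by rewrite leUx; apply/andP; split; apply/con_leP => a b ab;
    apply: rt_step; [left|right].
have smed z : s (median x y z) x.
  rewrite -{2}(medianxxz x z) /median.
  by do !apply: con_join; apply: con_meet; (exact: con_refl || exact: con_sym sxy).
suff vmed z z' : con_chain t u z z' -> v (median x y z) (median x y z').
  by move=> xy; have := vmed _ _ xy; rewrite medianxyx medianxyy; exact.
elim=> {z z'} [z z' zz'|z|z w z' _ IH _ IH'].
- have szz' := con_trans (smed z) (con_sym (smed z')).
  case: zz' => zz'; [apply: le_v (leUl _ _) _ | apply: le_v (leUr _ _) _];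
    by split=> //; exact: median_con.
- exact: con_refl.
- exact: con_trans IH IH'.
Qed.

End Distributivity.

(** * Where the weak uniform refinement property holds *)

Section WeakUniformRefinement.

(** Decompositions of [mu e] are pulled back to decompositions of [e] with
    smaller pieces; the image of a refinement of the latter refines the former. *)
Lemma WURP_weak_distributive dS (S : bJoinSemilatticeType dS)
    dT (T : bJoinSemilatticeType dT) (mu : S -> T) (e : S) :
  slat_hom mu -> weak_distributive mu -> WURP_at e -> WURP_at (mu e).
Proof.
move=> [_ muU] wmu We I a b abe.
have mule x y : x <= y -> mu x <= mu y.
  by move=> xy; rewrite -(join_idPl xy) muU leUr.
have /choice[ab' Hab] i : exists ab : S * S,
    [/\ mu ab.1 <= a i, mu ab.2 <= b i & e = ab.1 `|` ab.2].
  by have [x [y ?]] := wmu _ _ _ (esym (abe i)); exists (x, y).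
have [|c [cab ce ctr]] := We I (fst \o ab') (snd \o ab').
  by move=> i /=; have [] := Hab i.
exists (fun i j => mu (c i j)); split => [i j|i j|i j k].
- have [ca cb] := cab i j; have [ai _ _] := Hab i; have [_ bj _] := Hab j.
  by split; [exact: le_trans (mule _ _ ca) ai | exact: le_trans (mule _ _ cb) bj].
- have [ca _] := cab i j; have [ai bi _] := Hab i; have [aj _ _] := Hab j.
  apply/le_anti/andP; split.
    rewrite !leUx -{2}(abe j) -{2}(abe i) leUl leUr !andbT -(abe i).
    exact: le_trans (le_trans (mule _ _ ca) ai) (leUl _ _).
  by rewrite -(ce i j) !muU !leU2.
- by rewrite -muU; exact: mule.
Qed.

(** The differences [a i `\` a j] refine: [a j] absorbs what they leave out of
    [a i], and they satisfy the triangle inequality. *)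
Lemma WURP_genBoolean dB (B : cbDistrLatticeType dB) (e : B) : WURP_at e.
Proof.
move=> I a b abe; exists (fun i j => a i `\` a j); split => [i j|i j|i j k].
- rewrite leBx leBLR; split => //.
  by rewrite abe -(abe i) leUl.
- by rewrite diffUK joinAC abe; apply/join_idPl; rewrite -(abe j) leUl.
- by rewrite leBLR joinCA diffKU joinCA diffUK joinCA leUl.
Qed.

(** Refinement for inequalities [t <= a i `|` b i] rather than equalities: in
    this form it passes to finite joins, so that only principal [t] need the
    splitting hypothesis. For [t = Theta u v], splitting gives [x i] in [[u, v]]
    congruent to [u] modulo [a i] and to [v] modulo [b i], and [c i j] is the
    least congruence that forces [x i <= x j]. *)
Lemma congruence_splitting_refine d (K : latticeType d) (t : congruence K) :
  congruence_splitting K -> con_compact t ->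
  forall (I : Type) (a b : I -> congruence K), (forall i, t <= a i `|` b i) ->
  exists c : I -> I -> congruence K,
    [/\ forall i j, con_compact (c i j),
        forall i j, c i j <= a i /\ c i j <= b j,
        forall i j, t <= c i j `|` a j `|` b i
      & forall i j k, c i k <= c i j `|` c j k].
Proof.
move=> Ksplit ct I a b; move: t ct; apply: compact_ind.
- move=> _; exists (fun _ _ => \bot); split=> [i j|i j|i j|i j k].
  + exact: compact0.
  + by rewrite !le0x.
  + exact: le0x.
  + exact: le0x.
- move=> s t IHs IHt sab.
  have {IHs} [i|c [cc cab cs ctr]] := IHs.
    exact: le_trans (leUl _ _) (sab i).
  have {IHt} [i|c' [cc' cab' cs' ctr']] := IHt.
    exact: le_trans (leUr _ _) (sab i).
  exists (fun i j => c i j `|` c' i j); split=> [i j|i j|i j|i j k].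
  + exact: compactU.
  + by have [? ?] := cab i j; have [? ?] := cab' i j; split; rewrite leUx;
      apply/andP.
  + rewrite leUx; apply/andP; split.
      by apply: le_trans (cs i j) _; rewrite !leU2// leUl.
    by apply: le_trans (cs' i j) _; rewrite !leU2// leUr.
  + by rewrite joinACA leU2.
- move=> u v uv uvab.
  have /choice[z Hz] i : exists z : K * K,
      [/\ u <= z.1 <= v, u <= z.2 <= v, z.1 `|` z.2 = v,
          a i u z.1 & b i u z.2].
    (* distributivity turns the inequality into a decomposition of Theta u v *)
    have Eu : Theta u v = (Theta u v `&` a i) `|` (Theta u v `&` b i).
      apply/le_anti; rewrite leUx !leIl !andbT.
      by apply: le_trans (con_meetUr _ _ _); rewrite lexI lexx uvab.
    have [x0 [x1 [? ? ? H0 H1]]] := Ksplit _ _ _ _ uv Eu.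
    exists (x0, x1); split => //=; apply/Theta_leP.
      exact: le_trans H0 (leIr _ _).
    exact: le_trans H1 (leIr _ _).
  pose x i := (z i).1; pose y i := (z i).2.
  have xu i : u <= x i by have [/andP[]] := Hz i.
  have xv i : x i <= v by have [/andP[]] := Hz i.
  have xyv i : x i `|` y i = v by have [] := Hz i.
  have ax i : a i u (x i) by have [] := Hz i.
  have bx i : b i v (x i).
    have [_ _ _ _ bi] := Hz i.
    have := con_join (con_refl _ (x i)) (con_sym bi).
    by rewrite xyv (join_idPl (xu i)).
  exists (fun i j => Theta (x j) (x i `|` x j)); split=> [i j|i j|i j|i j k].
  + exact: Theta_compact.
  + split; apply/Theta_leP.
      have := con_join (ax i) (con_refl _ (x j)).
      by rewrite (join_idPr (xu j)).
    apply: con_trans (con_sym (bx j)) _.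
    have := con_join (con_refl _ (x i)) (bx j).
    by rewrite (join_idPr (xv i)).
  + set w := _ `|` b i.
    have le_w (s : congruence K) p q : s <= w -> s p q -> w p q.
      by move/con_leP; apply.
    have cw : w (x j) (x i `|` x j).
      apply: le_w (Theta_refl _ _).
      by apply: le_trans (leUl _ _) (leUl _ _).
    have aw : w u (x j).
      by apply: le_w (ax j); apply: le_trans (leUr _ _) (leUl _ _).
    have bw : w v (x i) by apply: le_w (bx i); exact: leUr.
    apply/Theta_leP; apply: con_trans aw (con_trans cw _).
    have := con_join (con_sym bw) (con_refl _ (x j)).
    by rewrite (join_idPl (xv j)).
  + set w := Theta _ _ `|` _.
    have le_w (s : congruence K) p q : s <= w -> s p q -> w p q.
      by move/con_leP; apply.
    have ij : w (x j) (x i `|` x j) by apply: le_w (Theta_refl _ _); exact: leUl.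
    have jk : w (x k) (x j `|` x k) by apply: le_w (Theta_refl _ _); exact: leUr.
    apply/Theta_leP; apply: (con_trans jk).
    have := con_join ij (con_refl _ (x k)) => H.
    apply: (con_trans H); rewrite -joinA.
    exact: con_join (con_refl _ _) (con_sym jk).
Qed.

Lemma WURP_congruence_splitting d (K : latticeType d)
    (e : compact_congruence K) : congruence_splitting K -> WURP_at e.
Proof.
move=> Ksplit I a b abe.
have [|c [cc cab ce ctr]] := congruence_splitting_refine Ksplit
    (asboolW (ccon_compact e)) (a := fun i => ccon_val (a i))
    (b := fun i => ccon_val (b i)).
  by move=> i; rewrite -(abe i).
exists (fun i j => CompactCongruence (asboolT (cc i j))); split=> //.
move=> i j; apply/le_anti/andP; split; last exact: ce.
have [ca _] := cab i j.
rewrite !leUx -{2}(abe j) -{2}(abe i) leUl leUr !andbT -(abe i).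
exact: le_trans (leUl (a i) (b i)).
Qed.

End WeakUniformRefinement.

(** * Free triples in sets of cardinality aleph_2 *)

Section FreeTriple.
Local Open Scope classical_set_scope.
Local Open Scope card_scope.

Lemma infinite_set_seq (X : Type) (A : set X) : infinite_set A ->
  exists2 alpha : nat -> X, injective alpha & forall n, A (alpha n).
Proof.
elim/Ppointed: X => X in A *.
  by rewrite (empty_eq0 A) => H; case: H; exact: finite_set0.
move=> /infiniteP/pcard_leP/injfunPex[alpha Aalpha inj].
exists alpha => [m n|n]; last exact: Aalpha.
by apply: inj; rewrite inE.
Qed.

Lemma countableU (X : Type) (A B : set X) :
  countable A -> countable B -> countable (A `|` B).
Proof.
by move=> ? ?; rewrite -bigcup2E; apply: bigcup_countable => // -[|[|i]] _ /=.
Qed.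

(** Up to finitely many points, [B] is a product with [nat]: a maximal disjoint
    family of injective sequences in [B] leaves no infinite remainder. This
    replaces the cardinal identity that the product of [B] with [nat] has the
    cardinality of [B]. *)
Lemma partition_into_sequences (X : Type) (B : set X) :
  exists G : set (nat -> X),
    [/\ forall g n, G g -> B (g n),
        forall g h m n, G g -> G h -> g m = h n -> g = h /\ m = n
      & finite_set [set x | B x /\ forall g n, G g -> g n <> x]].
Proof.
pose P (G : set (nat -> X)) := (forall g n, G g -> B (g n)) /\
  (forall g h m n, G g -> G h -> g m = h n -> g = h /\ m = n).
have [F FP Ftot|G [[GB Gdisj] Gmax]] := @Zorn_bigcup _ P.
  split=> [g n [G FG Gg]|g h m n [G FG Gg] [H FH Hh]].
    by have [GB _] := FP _ FG; exact: GB.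
  have [GH|HG] := Ftot _ _ FG FH.
    by have [_] := FP _ FH; apply => //; exact: GH.
  by have [_] := FP _ FG; apply => //; exact: HG.
exists G; split=> //; apply: contrapT => /infinite_set_seq[alpha inj Ralpha].
apply: (Gmax (alpha |` G)).
  split; first by move=> g Gg; right.
  move=> /(_ alpha (or_introl erefl)) Galpha.
  by have [_ /(_ alpha 0 Galpha)] := Ralpha 0.
split=> [g n [->|]|g h m n]; [by case: (Ralpha n) | exact: GB |].
move=> [->|Gg] [->|Gh]; last exact: Gdisj.
- by move/inj.
- by move=> E; have [_ /(_ h n Gh)] := Ralpha m; rewrite E.
- by move=> E; have [_ /(_ g m Gg)] := Ralpha n; rewrite E.
Qed.

(** The union of the countable sets [U b] has cardinality at most that of [B]: a
    point [x] is coded by a sequence [g], a place [m] with [U (g m) x], and the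
    rank of [x] in [U (g m)]; the last two numbers are merged into a single place
    of [g], which is again a point of [B]. The passage to [S], the points lying
    on some sequence, drops only finitely many points. *)
Lemma uncountable_not_covering (X : Type) (B : set X) (U : X -> set X) :
  ~ countable B -> ~ ([set: X] #<= B) -> (forall x, countable (U x)) ->
  exists2 S : set X, S `<=` B /\ ~ countable S &
    exists x, forall b, S b -> ~ U b x.
Proof.
move=> Bunc XB Ucnt; have [G [GB Gdisj Grest]] := partition_into_sequences B.
pose S := [set x | exists2 g, G g & exists n, g n = x].
exists S.
  split=> [_ [g Gg [n <-]]|Scnt]; first exact: GB.
  apply: Bunc; apply: (@sub_countable _ _ _
      (S `|` [set x | B x /\ forall g n, G g -> g n <> x])).
    apply: subset_card_le => x Bx; have [Sx|nSx] := EM (S x); first by left.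
    by right; split=> // g n Gg gnx; apply: nSx; exists g => //; exists n.
  by apply: countableU Scnt _; exact: finite_set_countable.
apply: contrapT => noX; apply: XB.
have /choice[gm Hgm] x : exists gm : (nat -> X) * nat,
    G gm.1 /\ U (gm.1 gm.2) x.
  apply: contrapT => H; apply: noX; exists x => _ [g Gg [n <-]] Ux.
  by apply: H; exists (g, n).
have /choice[code codeP] x : exists code : X -> nat, {in U x &, injective code}.
  exact/countable_injP.
pose f x := let: (g, m) := gm x in g (choice.pickle (m, code (g m) x)).
have f_inj : injective f.
  move=> x y; rewrite /f; have [] := Hgm x; have [] := Hgm y.
  case: (gm x) (gm y) => [g m] [h n] /= Gh Uy Gg Ux.
  move=> /(Gdisj _ _ _ _ Gg Gh)[gh /(pcan_inj choice.pickleK)[mn]].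
  rewrite -{}gh -{}mn in Uy *; apply: codeP; rewrite inE//.
have /card_eqPle[_ Xf] := inj_card_eq (A := [set: X]) (in2W f_inj).
apply: card_le_trans Xf (subset_card_le _) => _ [x _ <-]; rewrite /f.
by have [] := Hgm x; case: (gm x) => [g m] /= Gg _; exact: GB.
Qed.

(** Kuratowski's free set theorem for triples. Let [A] be a countably infinite
    subset and [U y] collect [A], [y] and all [Phi a y] with [a] in [A]. These
    sets are countable, so there are [k] and [j] with neither one in the set [U]
    of the other: [k] is chosen outside [U b] for uncountably many [b], and [j] among
    those [b] outside the countable set [U k]. Finally [Phi j k], being finite,
    misses some [i] in [A]. *)
Theorem free_triple (X : Type) (Phi : X -> X -> set X) :
  card_aleph 2 [set: X] -> (forall x y, finite_set (Phi x y)) ->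
  exists i j k, [/\ i <> j, j <> k, i <> k &
    [/\ ~ Phi i j k, ~ Phi i k j & ~ Phi j k i]].
Proof.
move=> [B [_ [A [AB A_nat BA _]] XB _]] Phi_fin.
have Acnt : countable A by rewrite /countable (card_le_eql A_nat).
have [|alpha alpha_inj Aalpha] := @infinite_set_seq _ A.
  by apply/infiniteP; have /card_eqPle[] := A_nat.
pose U y := A `|` (y |` \bigcup_(a in A) Phi a y).
have Ucnt y : countable (U y).
  apply: countableU => //; apply: countableU; first exact: countable1.
  by apply: bigcup_countable => // a Aa; exact: finite_set_countable.
have Bunc : ~ countable B.
  move=> Bcnt; apply: BA.
  by apply: card_le_trans Bcnt _; have /card_eqPle[] := A_nat.
have [S [SB Sunc] [k kS]] := uncountable_not_covering Bunc XB Ucnt.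
have [j [Sj Ukj]] : exists j, S j /\ ~ U k j.
  apply: contrapT => H; apply: Sunc; apply: sub_countable (Ucnt k).
  apply: subset_card_le => j Sj; apply: contrapT => Ukj.
  by apply: H; exists j.
have [i [Ai Pjki]] : exists i, A i /\ ~ Phi j k i.
  apply: contrapT => H.
  have /infiniteP : [set: nat] #<= A by have /card_eqPle[] := A_nat.
  apply; apply: sub_finite_set (Phi_fin j k) => i Ai; apply: contrapT => nP.
  by apply: H; exists i.
have Ujk := kS _ Sj.
exists i, j, k; split; last split => //.
- by move=> ij; apply: Ukj; left; rewrite -ij.
- by move=> jk; apply: Ujk; right; left.
- by move=> ik; apply: Ujk; left; rewrite -ik.
- by move=> Pijk; apply: Ujk; right; right; exists i.
- by move=> Pikj; apply: Ukj; right; right; exists i.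
Qed.

End FreeTriple.

(** * Free bounded lattices and their homomorphisms *)

Section LatticeMorphisms.
Context d (T : latticeType d) d' (T' : latticeType d') (f : T -> T').
Hypotheses (fI : Order.meet_morphism f) (fU : Order.join_morphism f).

Fact meet_morphism_homo : {homo f : x y / x <= y}.
Proof. by move=> x y /meet_idPl xy; rewrite -xy fI leIr. Qed.

Definition lmorphism_fun of Order.meet_morphism f & Order.join_morphism f := f.

HB.instance Definition _ := Order.isOrderMorphism.Build d T d' T'
  (lmorphism_fun fI fU) meet_morphism_homo.
HB.instance Definition _ := Order.isLatticeMorphism.Build d T d' T'
  (lmorphism_fun fI fU) fI fU.

Definition lmorphism_of : {lmorphism T -> T'} := lmorphism_fun fI fU.

End LatticeMorphisms.

Section GeneratedSublattice.
Context (X : Type) dF (F : tbLatticeType dF) (iota : X -> F).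

Inductive generated : F -> Prop :=
  | gen_var x : generated (iota x)
  | gen_bot : generated \bot
  | gen_top : generated \top
  | gen_meet y z : generated y -> generated z -> generated (y `&` z)
  | gen_join y z : generated y -> generated z -> generated (y `|` z).

Definition in_generated : pred F := fun y => `[< generated y >].
Definition gen_lattice := {y : F | in_generated y}.

Fact in_generatedI : meet_closed in_generated.
Proof. by move=> y z /asboolP gy /asboolP gz; apply/asboolP/gen_meet. Qed.
Fact in_generatedU : join_closed in_generated.
Proof. by move=> y z /asboolP gy /asboolP gz; apply/asboolP/gen_join. Qed.
Fact in_generated0 : \bot \in in_generated.
Proof. exact/asboolP/gen_bot. Qed.
Fact in_generated1 : \top \in in_generated.
Proof. exact/asboolP/gen_top. Qed.

HB.instance Definition _ := SubChoice.on gen_lattice.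
HB.instance Definition _ := Order.SubChoice_isTBSubLattice.Build dF F
  in_generated dF gen_lattice
  in_generatedI in_generatedU in_generated0 in_generated1.

Lemma val_leval (v : nat -> gen_lattice) (w : lterm) :
  val (leval v w) = leval (val \o v) w.
Proof.
elim: w => [//|w1 IH1 w2 IH2|w1 IH1 w2 IH2].
  by transitivity (val (leval v w1) `&` val (leval v w2)); rewrite //= -IH1 -IH2.
by transitivity (val (leval v w1) `|` val (leval v w2)); rewrite //= -IH1 -IH2.
Qed.

Lemma variety_gen_generated dA (A : latticeType dA) :
  variety_gen A F -> variety_gen A gen_lattice.
Proof.
move=> VF E AE w Ew v; apply: val_inj; rewrite !val_leval.
exact: (VF E AE w Ew).
Qed.

End GeneratedSublattice.

Section FreeLattice.
Context dA (A : latticeType dA) (X : Type) dF (F : tbLatticeType dF).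
Variable (iota : X -> F).
Hypothesis Ffree : free_bounded_lattice (@variety_gen dA A) iota.

(** The universal map into the generated sublattice, followed by the inclusion,
    fixes the generators; it is therefore the identity. *)
Lemma free_generated y : generated iota y.
Proof.
have [VF univ] := Ffree.
pose g x : gen_lattice iota := exist _ (iota x) (asboolT (gen_var iota x)).
have [h [h0 h1 hg _]] := univ _ _ g (variety_gen_generated VF).
have [k [_ _ _ kuniq]] := univ _ _ iota VF.
have [vh vhE] : exists vh : {lmorphism F -> F}, vh =1 (fun y => val (h y)).
  have vhI : Order.meet_morphism (fun y => val (h y)).
    by move=> u v; rewrite omorphI.
  have vhU : Order.join_morphism (fun y => val (h y)).
    by move=> u v; rewrite omorphU.
  by exists (lmorphism_of vhI vhU).
have vhy : vh y = k y.
  apply: kuniq => [||x]; rewrite vhE.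
  - by rewrite h0.
  - by rewrite h1.
  - by rewrite hg.
have idy : idfun y = k y by apply: kuniq.
rewrite [y]idy -vhy vhE.
exact/asboolP/(valP (h y)).
Qed.

Context dD (D : tbLatticeType dD).
Definition bounded_hom (h : {lmorphism F -> D}) := h \bot = \bot /\ h \top = \top.

Lemma hom_finite_support y : exists2 S : set X, finite_set S &
  forall h h' : {lmorphism F -> D}, bounded_hom h -> bounded_hom h' ->
    (forall x, S x -> h (iota x) = h' (iota x)) -> h y = h' y.
Proof.
elim: (free_generated y) => {y} [x|||y z _ [S fS HS] _ [T fT HT]
  |y z _ [S fS HS] _ [T fT HT]].
- exists [set x]%classic; first exact: finite_set1.
  by move=> h h' _ _; apply.
- by exists set0; [exact: finite_set0 | move=> h h' [-> _] [-> _]].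
- by exists set0; [exact: finite_set0 | move=> h h' [_ ->] [_ ->]].
- exists (S `|` T)%classic; first by rewrite finite_setU.
  move=> h h' bh bh' ST; rewrite !omorphI.
  by congr (_ `&` _); [apply: HS | apply: HT] => // x ?; apply: ST; [left|right].
- exists (S `|` T)%classic; first by rewrite finite_setU.
  move=> h h' bh bh' ST; rewrite !omorphU.
  by congr (_ `|` _); [apply: HS | apply: HT] => // x ?; apply: ST; [left|right].
Qed.

(** The sublattice [{\bot, p, q, \top}] is a square, and [h1], [h2] are the two
    coordinates of [h]. *)
Lemma hom_two_valued_square (p q : D) (h1 h2 h : {lmorphism F -> D}) :
  p `&` q = \bot -> p `|` q = \top ->
  bounded_hom h1 -> bounded_hom h2 -> bounded_hom h ->
  (forall x, [\/ [/\ h1 (iota x) = \bot, h2 (iota x) = \bot & h (iota x) = \bot],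
     [/\ h1 (iota x) = \top, h2 (iota x) = \bot & h (iota x) = p] |
     [/\ h1 (iota x) = \bot, h2 (iota x) = \top & h (iota x) = q]]) ->
  forall y z, h1 y = h1 z -> h2 y = h2 z -> h y = h z.
Proof.
move=> pqI pqU [h10 h11] [h20 h21] [h0 h1'] Hx.
suff H y : [/\ h1 y = \bot \/ h1 y = \top, h2 y = \bot \/ h2 y = \top &
    h y = (p `&` h1 y) `|` (q `&` h2 y)].
  by move=> y z E1 E2; have [_ _ ->] := H y; have [_ _ ->] := H z; rewrite E1 E2.
elim: (free_generated y) => {y} [x|||y z _ IHy _ IHz|y z _ IHy _ IHz].
- by case: (Hx x) => -[-> -> ->]; rewrite ?meetx0 ?meetx1 ?joinx0 ?join0x; split;
    auto.
- by rewrite h10 h20 h0 !meetx0 joinxx; split; auto.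
- by rewrite h11 h21 h1' !meetx1 pqU; split; auto.
- rewrite !omorphI /=; case: IHy IHz => -[->|->] [->|->] -> [[->|->] [->|->] ->];
  rewrite ?(meetx0, meet0x, meetx1, joinx0, join0x, meetxx, pqU, meet1x);
  split; auto; rewrite ?pqI ?[q `&` p]meetC ?pqI; auto.
- rewrite !omorphU /=; case: IHy IHz => -[->|->] [->|->] -> [[->|->] [->|->] ->];
  rewrite ?(meetx0, meet0x, meetx1, joinx0, join0x, joinxx, pqU, joinx1, join1x);
  split; auto; rewrite ?[q `|` p]joinC ?pqU; auto.
Qed.

(** The values of [h] split into those below [p] and those above [r], two
    disjoint classes as [r <= p] fails; [k] only records the class. *)
Lemma hom_separate (p r : D) (h k : {lmorphism F -> D}) :
  ~~ (r <= p) -> bounded_hom h -> bounded_hom k ->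
  (forall x, (k (iota x) = \bot /\ h (iota x) <= p) \/
     (k (iota x) = \top /\ r <= h (iota x))) ->
  forall y z, h y = h z -> k y = k z.
Proof.
move=> rp [h0 h1] [k0 k1] Hx.
have H y : (k y = \bot /\ h y <= p) \/ (k y = \top /\ r <= h y).
  elim: (free_generated y) => {y} [//|||y z _ IHy _ IHz|y z _ IHy _ IHz].
  - by left; rewrite h0 le0x.
  - by right; rewrite h1 lex1.
  - rewrite !omorphI /=; case: IHy IHz => [[-> ?]|[-> ?]] [[-> ?]|[-> ?]].
    + by left; rewrite meet0x leIxl.
    + by left; rewrite meet0x leIxl.
    + by left; rewrite meetx0 leIxr.
    + by right; rewrite meetxx lexI; split=> //; apply/andP.
  - rewrite !omorphU /=; case: IHy IHz => [[-> ?]|[-> ?]] [[-> ?]|[-> ?]].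
    + by left; rewrite joinxx leUx; split=> //; apply/andP.
    + by right; rewrite joinx1 lexUr.
    + by right; rewrite join1x lexUl.
    + by right; rewrite join1x lexUl.
move=> y z hyz; case: (H y) (H z) => [[-> hy]|[-> hy]] [[-> hz]|[-> hz]] //.
  by case/negP: rp; rewrite (le_trans hz)// -hyz.
by case/negP: rp; rewrite (le_trans hy)// hyz.
Qed.

End FreeLattice.

(** * Failure of the property over a free lattice *)

Section WURPFailure.
Context dA (A : latticeType dA) (X : Type) dF (F : tbLatticeType dF).
Variable iota : X -> F.
Hypothesis Ffree : free_bounded_lattice (@variety_gen dA A) iota.
Hypothesis Xcard : card_aleph 2 [set: X]%classic.
Context dD (D : tbLatticeType dD).
Hypothesis VD : variety_gen A D.
Context dL (L : latticeType dL) (f : {lmorphism L -> F}).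
Hypothesis fsurj : forall y, exists x, f x = y.

Program Definition pullback_ker (h : {lmorphism F -> D}) : congruence L :=
  @Congruence dL L (fun x y => h (f x) = h (f y)) _ _ _ _ _.
Next Obligation. by []. Qed.
Next Obligation. by move=> h x y; exact: esym. Qed.
Next Obligation. by move=> h x y z; exact: etrans. Qed.
Next Obligation.
by move=> h x x' y y' /= Ex Ey; rewrite !omorphI; congr (_ `&` _).
Qed.
Next Obligation.
by move=> h x x' y y' /= Ex Ey; rewrite !omorphU; congr (_ `|` _).
Qed.

Lemma compact_finite_support (t : congruence L) : con_compact t ->
  exists S : set X, finite_set S /\
    forall h h' : {lmorphism F -> D}, bounded_hom h -> bounded_hom h' ->
      (forall x, S x -> h (iota x) = h' (iota x)) ->
      t <= pullback_ker h -> t <= pullback_ker h'.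
Proof.
move: t; apply: compact_ind => [|s t [S [fS HS]] [T [fT HT]]|a b _].
- by exists set0; split; [exact: finite_set0 | move=> *; exact: le0x].
- exists (S `|` T)%classic; split; first by rewrite finite_setU.
  move=> h h' bh bh' ST; rewrite !leUx => /andP[sh th]; apply/andP; split.
    by apply: HS sh => // x Sx; apply: ST; left.
  by apply: HT th => // x Tx; apply: ST; right.
- have [S fS HS] := hom_finite_support Ffree D (f a).
  have [T fT HT] := hom_finite_support Ffree D (f b).
  exists (S `|` T)%classic; split; first by rewrite finite_setU.
  move=> h h' bh bh' ST /Theta_leP /= hab; apply/Theta_leP => /=.
  rewrite -(HS h h') ?hab ?(HT h h')// => x ?; apply: ST; by [left|right].
Qed.

Lemma free_hom (g : X -> D) :
  exists2 h : {lmorphism F -> D}, bounded_hom h & forall x, h (iota x) = g x.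
Proof. by have [_ /(_ _ _ g VD)[h [? ? ? _]]] := Ffree; exists h. Qed.

Lemma surj_lift (z0 z1 : L) (y : F) : z0 <= z1 -> f z0 = \bot -> f z1 = \top ->
  exists x, [/\ f x = y, z0 <= x & x <= z1].
Proof.
move=> z01 f0 f1; have [x fx] := fsurj y.
exists ((x `|` z0) `&` z1); split; last exact: leIr.
  by rewrite omorphI /= omorphU /= fx f0 f1 joinx0 meetx1.
by rewrite lexI leUr.
Qed.

Theorem WURP_fails_at_Theta (p q r : D) (z0 z1 : L) :
  p `&` q = \bot -> p `|` q = \top -> q `&` r = \bot -> q `|` r = \top ->
  ~~ (r <= p) ->
  z0 <= z1 -> f z0 = \bot -> f z1 = \top -> ~ WURP_at (Theta_c z0 z1).
Proof.
move=> pqI pqU qrI qrU rp z01 f0 f1 W.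
have /choice[y Hy] x := surj_lift (iota x) z01 f0 f1.
have fy x : f (y x) = iota x by have [] := Hy x.
pose u x := Theta_c z0 (y x); pose v x := Theta_c (y x) z1.
have uv x : ccon_val (u x) `|` ccon_val (v x) = Theta z0 z1.
  by apply: Theta_split; have [_ ->] := Hy x.
(* The decomposition of each generator is used in both orders. *)
pose a (s : X * bool) := if s.2 then u s.1 else v s.1.
pose b (s : X * bool) := if s.2 then v s.1 else u s.1.
have [|c [cab ce ctr]] := W _ a b.
  by case=> x [] /=; apply: val_inj; rewrite ?[RHS]/= -(uv x) // [RHS]joinC.
have /choice[supp suppP] (st : (X * bool) * (X * bool)) :=
  compact_finite_support (asboolW (ccon_compact (c st.1 st.2))).
have fin_supp st : finite_set (supp st) by have [] := suppP st.
(* These are the three pairs of indices that occur below, for the couples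
   (i, j), (j, k) and (i, k) in this order. *)
pose Phi x x' := (supp ((x, false), (x', true)) `|`
  (supp ((x, true), (x', false)) `|` supp ((x, false), (x', false))))%classic.
have [|i [j [k [ij jk ik [nk nj ni]]]]] := free_triple (Phi := Phi) Xcard.
  by move=> x x'; rewrite !finite_setU.
pose asg (al be ga : D) x : D := if `[< x = i >] then al else
  if `[< x = j >] then be else if `[< x = k >] then ga else \bot.
have hom al be ga := free_hom (asg al be ga).
have killu (h : {lmorphism F -> D}) x : bounded_hom h -> h (iota x) = \bot ->
    ccon_val (u x) <= pullback_ker h.
  by move=> [h0 h1] hx; apply/Theta_leP => /=; rewrite f0 fy h0 hx.
have killv (h : {lmorphism F -> D}) x : bounded_hom h -> h (iota x) = \top ->
    ccon_val (v x) <= pullback_ker h.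
  by move=> [h0 h1] hx; apply/Theta_leP => /=; rewrite f1 fy h1 hx.
have asgi al be ga : asg al be ga i = al by rewrite /asg; case: asboolP.
have asgj al be ga : asg al be ga j = be.
  rewrite /asg; case: asboolP => [ji|_]; first by case: ij.
  by case: asboolP.
have asgk al be ga : asg al be ga k = ga.
  rewrite /asg; case: asboolP => [ki|_]; first by case: ik.
  case: asboolP => [kj|_]; first by case: jk.
  by case: asboolP.
have ca s t : ccon_val (c s t) <= ccon_val (a s) by have [] := cab s t.
have cb s t : ccon_val (c s t) <= ccon_val (b t) by have [] := cab s t.
have [h100 b100 E100] := hom \top \bot \bot.
have [h010 b010 E010] := hom \bot \top \bot.
have [h001 b001 E001] := hom \bot \bot \top.
have [hpq0 bpq0 Epq0] := hom p q \bot.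
have [h0qr b0qr E0qr] := hom \bot q r.
have [hp0r bp0r Ep0r] := hom p \bot r.
have [hpqr bpqr Epqr] := hom p q r.
have cij_pq0 : ccon_val (c (i, false) (j, true)) <= pullback_ker hpq0.
  have /con_leP k1 := le_trans (ca (i, false) (j, true))
    (killv h100 i b100 (etrans (E100 i) (asgi _ _ _))).
  have /con_leP k2 := le_trans (cb (i, false) (j, true))
    (killv h010 j b010 (etrans (E010 j) (asgj _ _ _))).
  apply/con_leP => s t st /=.
  apply: (hom_two_valued_square Ffree pqI pqU b100 b010 bpq0 _
    (k1 _ _ st) (k2 _ _ st)).
  move=> x; rewrite E100 E010 Epq0 /asg.
  case: asboolP => _; first by constructor 2.
  case: asboolP => _; first by constructor 3.
  by case: asboolP => _; constructor 1.
have cjk_0qr : ccon_val (c (j, true) (k, false)) <= pullback_ker h0qr.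
  have /con_leP k1 := le_trans (ca (j, true) (k, false))
    (killu h001 j b001 (etrans (E001 j) (asgj _ _ _))).
  have /con_leP k2 := le_trans (cb (j, true) (k, false))
    (killu h010 k b010 (etrans (E010 k) (asgk _ _ _))).
  apply/con_leP => s t st /=.
  apply: (hom_two_valued_square Ffree qrI qrU b010 b001 b0qr _
    (k2 _ _ st) (k1 _ _ st)).
  move=> x; rewrite E010 E001 E0qr /asg.
  case: asboolP => _; first by constructor 1.
  case: asboolP => _; first by constructor 2.
  by case: asboolP => _; [constructor 3 | constructor 1].
have cij_pqr : ccon_val (c (i, false) (j, true)) <= pullback_ker hpqr.
  have [_ H] := suppP ((i, false), (j, true)).
  apply: (H hpq0 hpqr) => // x Sx; rewrite Epq0 Epqr /asg.
  do 2!(case: asboolP => // _); case: asboolP => // xk.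
  by case: nk; left; rewrite -xk.
have cjk_pqr : ccon_val (c (j, true) (k, false)) <= pullback_ker hpqr.
  have [_ H] := suppP ((j, true), (k, false)).
  apply: (H h0qr hpqr) => // x Sx; rewrite E0qr Epqr /asg.
  case: asboolP => // xi.
  by case: ni; right; left; rewrite -xi.
have cik_pqr : ccon_val (c (i, false) (k, false)) <= pullback_ker hpqr.
  have /le_trans : ccon_val (c (i, false) (k, false)) <=
    ccon_val (c (i, false) (j, true)) `|` ccon_val (c (j, true) (k, false)).
    exact: ctr.
  by apply; rewrite leUx cij_pqr cjk_pqr.
have cik_p0r : ccon_val (c (i, false) (k, false)) <= pullback_ker hp0r.
  have [_ H] := suppP ((i, false), (k, false)).
  apply: (H hpqr hp0r) => // x Sx; rewrite Ep0r Epqr /asg.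
  case: asboolP => // _; case: asboolP => // xj.
  by case: nj; right; right; rewrite -xj.
have cik_001 : ccon_val (c (i, false) (k, false)) <= pullback_ker h001.
  apply/con_leP => s t st /=.
  apply: (hom_separate Ffree rp bp0r b001 _ ((con_leP _ _ cik_p0r) _ _ st)) => x.
  rewrite E001 Ep0r /asg; case: asboolP => _; first by left.
  case: asboolP => _; first by rewrite le0x; left.
  by case: asboolP => _; [right | left; rewrite le0x].
have : ccon_val (Theta_c z0 z1) <= pullback_ker h001.
  rewrite -(ce (i, false) (k, false)) !leUx cik_001 /=; apply/andP; split.
    by apply: killv => //; rewrite E001.
  by apply: killu => //; rewrite E001.
move/Theta_leP => /=; rewrite f0 f1; have [-> ->] := b001 => bot_top.
by case/negP: rp; rewrite (le_trans (lex1 _))// -bot_top le0x.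
Qed.

Lemma ex_lift_bounds :
  exists z0 z1 : L, [/\ z0 <= z1, f z0 = \bot & f z1 = \top].
Proof.
have [z0 f0] := fsurj \bot; have [z1 f1] := fsurj \top.
exists z0, (z0 `|` z1); split => //; first exact: leUl.
by rewrite omorphU /= f1 joinx1.
Qed.

(** Finitely many intervals of [L] lie in a single one, which may be enlarged so
    that [f] sends it onto bounds. *)
Lemma compact_le_Theta (t : congruence L) : con_compact t ->
  exists z0 z1 : L, [/\ z0 <= z1, f z0 = \bot, f z1 = \top & t <= Theta z0 z1].
Proof.
have [y0 [y1 [y01 f0 f1]]] := ex_lift_bounds.
have widen x0 x1 z0 z1 : x0 <= z0 -> z0 <= z1 -> z1 <= x1 ->
    Theta z0 z1 <= Theta x0 x1.
  move=> xz zz zx; rewrite -(@Theta_split _ _ x0 z0 x1) ?xz ?(le_trans zz)//.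
  by rewrite -(@Theta_split _ _ z0 z1 x1) ?zz// lexUr// leUl.
move: t; apply: compact_ind => [|s t [u0 [u1 [u01 fu0 fu1 su]]]
    [v0 [v1 [v01 fv0 fv1 tv]]]|a b ab].
- by exists y0, y1; rewrite le0x.
- exists (u0 `&` v0), (u1 `|` v1); split.
  + by rewrite leIxl// lexUl.
  + by rewrite omorphI /= fu0 meet0x.
  + by rewrite omorphU /= fu1 join1x.
  + rewrite leUx; apply/andP; split.
      by apply: (le_trans su); apply: widen; rewrite ?leIl ?leUl.
    by apply: (le_trans tv); apply: widen; rewrite ?leIr ?leUr.
- exists (y0 `&` a), (y1 `|` b); split.
  + by rewrite leIxl// lexUl.
  + by rewrite omorphI /= f0 meet0x.
  + by rewrite omorphU /= f1 join1x.
  + by apply: widen; rewrite ?leIr ?leUr.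
Qed.

(** The result for an arbitrary variety that contains a bounded lattice in which
    complements are not unique. *)
Theorem congruence_semilattice_not_WURP (p q r : D) :
  p `&` q = \bot -> p `|` q = \top -> q `&` r = \bot -> q `|` r = \top ->
  ~~ (r <= p) ->
  [/\ ~ exists2 e : compact_congruence L,
         ccon_val e = (\top : congruence L) & WURP_at e,
      ~ exists (dK : Order.disp_t) (K : latticeType dK),
         congruence_splitting K /\
         slat_iso (compact_congruence K) (compact_congruence L)
    & ~ Schmidt (compact_congruence L)].
Proof.
move=> pqI pqU qrI qrU rp.
have [z0 [z1 [z01 f0 f1]]] := ex_lift_bounds.
have noW := WURP_fails_at_Theta pqI pqU qrI qrU rp.
split.
- move=> [e etop We]; have ce := asboolW (ccon_compact e).
  have [w0 [w1 [w01 fw0 fw1 ew]]] := compact_le_Theta ce.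
  apply: (noW _ _ w01 fw0 fw1).
  suff -> : Theta_c w0 w1 = e by [].
  by apply: val_inj; apply/le_anti; rewrite /= ew etop lex1.
- move=> [dK [K [Ksplit [mu [muhom [nu nuK muK]]]]]].
  apply: (noW _ _ z01 f0 f1); rewrite -[Theta_c _ _]muK.
  apply: (WURP_weak_distributive muhom); last exact: WURP_congruence_splitting.
  move=> e b0 b1 Eb; exists (nu b0), (nu b1); rewrite !muK !lexx; split=> //.
  by apply: (can_inj nuK); rewrite Eb (proj2 muhom) !muK.
- move=> [dB [B [mu [muhom wmu musurj]]]].
  have [e Ee] := musurj (Theta_c z0 z1).
  apply: (noW _ _ z01 f0 f1); rewrite -Ee.
  by apply: (WURP_weak_distributive muhom wmu); exact: WURP_genBoolean.
Qed.

End WURPFailure.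

(** * The diamond and the pentagon *)

Fact M3_le0x (x : M3) : M3_0 <= x. Proof. by case: x. Qed.
Fact M3_lex1 (x : M3) : x <= M3_1. Proof. by case: x. Qed.
HB.instance Definition _ := Order.hasBottom.Build M3_display M3 M3_le0x.
HB.instance Definition _ := Order.hasTop.Build M3_display M3 M3_lex1.

Fact N5_le0x (x : N5) : N5_0 <= x. Proof. by case: x. Qed.
Fact N5_lex1 (x : N5) : x <= N5_1. Proof. by case: x. Qed.
HB.instance Definition _ := Order.hasBottom.Build N5_display N5 N5_le0x.
HB.instance Definition _ := Order.hasTop.Build N5_display N5 N5_lex1.

Close Scope order_scope.

Theorem corollary4p1
  (dL : Order.disp_t) (L : latticeType dL)
  (dF : Order.disp_t) (F : tbLatticeType dF)
  (X : Type) (iota : X -> F)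
  (hX : card_aleph 2 [set: X]%classic)
  (hF : free_bounded_lattice (@variety_gen M3_display M3) iota \/
        free_bounded_lattice (@variety_gen N5_display N5) iota)
  (f : {lmorphism L -> F})
  (hf : forall y : F, exists x : L, f x = y) :
  (~ exists2 e : compact_congruence L,
       ccon_val e = (\top : congruence L)%O & WURP_at e) /\
  (~ exists (dK : Order.disp_t) (K : latticeType dK),
       congruence_splitting K /\
       slat_iso (compact_congruence K) (compact_congruence L)) /\
  ~ Schmidt (compact_congruence L).
Proof.
suff [] : [/\ ~ exists2 e : compact_congruence L,
       ccon_val e = (\top : congruence L)%O & WURP_at e,
  ~ exists (dK : Order.disp_t) (K : latticeType dK),
       congruence_splitting K /\
       slat_iso (compact_congruence K) (compact_congruence L) &
  ~ Schmidt (compact_congruence L)] by [].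
case: hF => Ffree.
- exact: (congruence_semilattice_not_WURP Ffree hX (D := M3) _ hf
    (p := M3_a) (q := M3_b) (r := M3_c)).
- exact: (congruence_semilattice_not_WURP Ffree hX (D := N5) _ hf
    (p := N5_c) (q := N5_b) (r := N5_a)).
Qed.
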